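(* Let $q \geq 2$ and $h \geq 1$ be fixed integers. If $\mathcal H$ is a family of graphs none of which contains a $q$-ary tree of height $h$ as a subgraph, then, as $d \to \infty$, \[ \ell_{\mathcal H}(d) \leq (1+o_{q,h}(1))\frac{\log d}{\log^{(h)} d} + O_q(1). \]
   Context: All graphs are finite. Let $\mathcal G = \{G_1,\dots,G_k\}$ be a family of graphs, where $G_i$ has vertex set $V_i$ (the sets $V_i$ may overlap), and let $V = V_1\cup\dots\cup V_k$. A cooperative list coloring of $\mathcal G$ is a family of sets $R_1,\dots,R_k$ with $R_i \subseteq V_i$, each $R_i$ an independent set of $G_i$, and $V = \bigcup_{i=1}^k R_i$. For a graph class $\mathcal H$, $\ell_{\mathcal H}(d)$ denotes the minimum value $\ell$ such that whenever $\mathcal G$ is a family of graphs from $\mathcal H$, each of maximum degree at most $d$, whose vertex sets are subsets of a universal vertex set $V$, and each vertex of $V$ belongs to at least $\ell$ graphs of $\mathcal G$, then $\mathcal G$ has a cooperative list coloring. In a rooted tree with root $r$, the height of a vertex is its distance to $r$, and the height of the tree is the maximum height of its vertices. A $q$-ary tree of height $h$ is a rooted tree in which every vertex of height at most $h-1$ has exactly $q$ children (so all leaves have height $h$). $\log^{(k)} d$ denotes the $k$-fold iterated natural logarithm $\log\log\cdots\log d$. The notation $o_{q,h}(1)$ denotes a function tending to $0$ as $d\to\infty$ whose rate may depend on $q,h$, and $O_q(1)$ a quantity bounded by a constant depending only on $q$. *)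

(* Defs.v *)
From mathcomp Require Import all_boot.
From Stdlib Require Import Reals.
Set Implicit Arguments. Unset Strict Implicit. Unset Printing Implicit Defensive.

Record sgraph := SGraph {
  vert : finType;
  adj : rel vert;
  adj_sym : symmetric adj;
  adj_irr : irreflexive adj }.

Definition maxdeg_le (G : sgraph) (d : nat) : Prop :=
  forall x : vert G, #|[set y | adj x y]| <= d.

Definition independent (G : sgraph) (S : {set vert G}) : Prop :=
  forall x y, x \in S -> y \in S -> ~~ adj x y.

(* G contains the q-ary tree of height h as a (not necessarily induced)
   subgraph.  The q-ary tree of height h is modelled with vertex set the
   words over 'I_q of length <= h (root = empty word), the children of s
   being rcons s a; an embedding is injective on those words and maps each
   parent-child pair to an edge. *)
Definition contains_qary_tree (q h : nat) (G : sgraph) : Prop :=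
  exists phi : seq 'I_q -> vert G,
    (forall s t, size s <= h -> size t <= h -> phi s = phi t -> s = t) /\
    (forall s (a : 'I_q), size s < h -> adj (phi s) (phi (rcons s a))).

(* A family G_1..G_k of graphs whose vertex sets are subsets of a universal
   vertex set V: vertex set of G_i is the image of the injection f i. *)
Definition coop_colorable (V : finType) (k : nat) (G : 'I_k -> sgraph)
  (f : forall i, vert (G i) -> V) : Prop :=
  exists R : forall i, {set vert (G i)},
    (forall i, independent (R i)) /\
    (forall v : V, exists i, exists2 x, x \in R i & f i x = v).

Definition coop_prop (H : sgraph -> Prop) (d l : nat) : Prop :=
  forall (V : finType) (k : nat) (G : 'I_k -> sgraph)
         (f : forall i, vert (G i) -> V),
    (forall i, H (G i)) ->
    (forall i, injective (f i)) ->
    (forall i, maxdeg_le (G i) d) ->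
    (forall v : V, l <= #|[set i | v \in codom (f i)]|) ->
    coop_colorable f.

(* ell_H(d) <= B, where ell_H(d) is the minimum l with coop_prop H d l. *)
Definition ell_le (H : sgraph -> Prop) (d : nat) (B : R) : Prop :=
  exists l : nat, (INR l <= B)%R /\ coop_prop H d l.

Definition iter_log (k : nat) (x : R) : R := iter k ln x.

(* Main.v *)
(** Call level 0 of a graph all its vertices, and level [j+1] the vertices with
    at least [N] neighbours in level [j]. For [N] large in terms of [q] and [h],
    a vertex of level [h] is the root of a greedily embedded [q]-ary tree of
    height [h]; hence in a tree-free graph level [h] is empty, and a vertex whose
    highest level is [j] has at most [N] neighbours of highest level [>= j].

    By pigeonhole every [v : V] has a type [s < h] such that [v] has highest
    level [s] in [m + (h-1-s) k] of its graphs; these graphs form its list. The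
    types are coloured in decreasing order from these lists. While type [t] is
    coloured, every vertex of smaller type may lose at most [k] colours of its
    list to its neighbours of type [t], so at least [m] colours are left when
    its turn comes. That a type can be coloured in this way follows from
    Rosenfeld's counting argument: adding one vertex to the coloured set
    multiplies the number of admissible partial colourings by at least [m/2],
    provided [8 N <= m] and [4 d 2^(m + h k) (2 N)^k <= m^k].

    With [x = log d] and [y = log x], one takes [m] about [x / y^2] and [k]
    about [x / y], so lists of size [2 m + k = (1 + o(1)) x / y] suffice for
    [h = 2] and [O_h (x / y)] for [h >= 3]. For [h = 1] there is only one type
    and no constraint involving [d], hence [m = 8 N] and [k = 0] work. *)

Require Import Defs.
From mathcomp Require Import all_boot.
From mathcomp Require Import zify.
From Stdlib Require Import ZArith Reals Lra.
From Coquelicot Require Import Coquelicot.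
(* Restores [^] on nat and the scope key [%N], both rebound by the Stdlib imports. *)
From mathcomp Require Import ssrnat.

Close Scope R_scope.

(** * Colouring a single type by Rosenfeld's counting argument *)

Section Stage.
Variables (V I : finType) (E : I -> rel V).

Definition blocked (c : {ffun V -> option I}) (A : {set I}) (u : V) : {set I} :=
  [set i in A | [exists w, E i u w && (c w == Some i)]].

Lemma blockedP (c : {ffun V -> option I}) (A : {set I}) u i :
  reflect (i \in A /\ exists2 w, E i u w & c w = Some i) (i \in blocked c A u).
Proof.
rewrite inE; apply: (iffP andP) => -[iA].
  by case/existsP=> w /andP[Ew /eqP cw]; split=> //; exists w.
by case=> w Ew cw; split=> //; apply/existsP; exists w; rewrite Ew cw eqxx.
Qed.

Lemma card_le_sum_cover (T J : finType) (X : {set T}) (B : {set J}) (F : J -> {set T}) :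
  (forall x, x \in X -> exists2 j, j \in B & x \in F j) ->
  #|X| <= \sum_(j in B) #|F j|.
Proof.
move=> cov; apply: (@leq_trans #|\bigcup_(j in B) F j|).
  apply/subset_leq_card/subsetP=> x /cov[j jB xF].
  by apply/bigcupP; exists j.
elim/big_rec2: _ => [|j y Y _ le]; first by rewrite cards0.
by apply: leq_trans (leq_add (leqnn _) le); rewrite cardsU leq_subr.
Qed.

(** [W] is the type being coloured, with lists [P] of size exactly [m]. [U] holds the vertices of
    smaller type, whose lists [Q] may each lose at most [k] colours at this stage. [N] bounds the
    degrees into [W], and [d] those from [W] into [U]. *)
Variables (W U : {set V}) (P Q : V -> {set I}) (m N d L k : nat).
Hypothesis Eirr : forall i, irreflexive (E i).
Hypothesis Esym : forall i, symmetric (E i).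
Hypothesis Pm : forall w, w \in W -> #|P w| = m.
Hypothesis QL : forall u, u \in U -> #|Q u| <= L.
Hypothesis degW : forall w i, w \in W -> i \in P w ->
  #|[set w' in W | E i w w' && (i \in P w')]| <= N.
Hypothesis degUW : forall u i, u \in U -> i \in Q u ->
  #|[set w in W | E i u w && (i \in P w)]| <= N.
Hypothesis degWU : forall w i, w \in W -> i \in P w ->
  #|[set u in U | E i w u && (i \in Q u)]| <= d.
Hypothesis m_gt0 : 0 < m.
Hypothesis mN : 8 * N <= m.
Hypothesis mk : 4 * (d * 2 ^ L * (2 * N) ^ k) <= m ^ k.

Definition partial_coloring (S : {set V}) (c : {ffun V -> option I}) : Prop :=
  [/\ forall w, w \in S -> exists2 i, i \in P w & c w = Some i,
      forall w, w \notin S -> c w = None,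
      forall w w' i, c w = Some i -> c w' = Some i -> ~~ E i w w' &
      forall u, u \in U -> #|blocked c (Q u) u| <= k].

(** [locked] keeps [inE] from unfolding membership in this set. *)
Definition colorings (S : {set V}) : {set {ffun V -> option I}} :=
  locked [set c : {ffun V -> option I} | [&& [forall w, if w \in S then [exists i in P w, c w == Some i]
                          else c w == None],
    [forall w, forall w', forall i,
       (c w == Some i) && (c w' == Some i) ==> ~~ E i w w'] &
    [forall (u | u \in U), #|blocked c (Q u) u| <= k]]].

Lemma coloringsP (S : {set V}) c :
  reflect (partial_coloring S c) (c \in colorings S).
Proof.
rewrite /colorings -lock inE; apply: (iffP and3P) => -[].
  move=> /forallP h1 /forallP h2 /forall_inP h3; split=> // [w wS|w /negbTE wS|w w' i cw cw'].
  - by move: (h1 w); rewrite wS => /exists_inP[i iP /eqP ci]; exists i.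
  - by move: (h1 w); rewrite wS => /eqP.
  by move: (h2 w) => /forallP/(_ w')/forallP/(_ i); rewrite cw cw' eqxx.
move=> h1 h2 h3 h4; split.
- apply/forallP=> w; case: ifPn => wS; last by rewrite h2.
  by have [i iP ci] := h1 _ wS; apply/exists_inP; exists i; rewrite ?ci.
- apply/forallP=> w; apply/forallP=> w'; apply/forallP=> i.
  by apply/implyP=> /andP[/eqP cw /eqP]; apply: h3.
exact/forall_inP.
Qed.

Definition erase (c : {ffun V -> option I}) w : {ffun V -> option I} :=
  [ffun v => if v == w then None else c v].
Definition assign (c : {ffun V -> option I}) w i : {ffun V -> option I} :=
  [ffun v => if v == w then Some i else c v].

Lemma erase_Some c w v i : erase c w v = Some i -> v != w /\ c v = Some i.
Proof. by rewrite ffunE; case: eqP. Qed.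

Lemma erase_colorings S c w : c \in colorings S -> erase c w \in colorings (S :\ w).
Proof.
case/coloringsP=> h1 h2 h3 h4; apply/coloringsP; split=> [v|v|v v' i|u uU].
- by rewrite !inE ffunE => /andP[/negbTE-> /h1].
- by rewrite !inE ffunE; case: eqP => //= _ /h2.
- by case/erase_Some=> _ cv /erase_Some[_ cv']; apply: h3.
apply: leq_trans (h4 u uU); apply/subset_leq_card/subsetP=> i /blockedP[iQ [v Ev]].
by case/erase_Some=> _ cv; apply/blockedP; split=> //; exists v.
Qed.

(** Erasing [w] is injective on colourings that give [w] the same colour [i]. *)
Lemma card_colorings_fix (S : {set V}) w i (X Y : pred {ffun V -> option I}) :
  (forall c : {ffun V -> option I}, c w = Some i -> X c -> Y (erase c w)) ->
  #|[set c : {ffun V -> option I} in colorings S | (c w == Some i) && X c]|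
    <= #|[set c : {ffun V -> option I} in colorings (S :\ w) | Y c]|.
Proof.
move=> XY; set A := [set c : {ffun V -> option I} in colorings S | _].
rewrite -(@card_in_imset _ _ (erase ^~ w) A) => [|c c'].
  apply/subset_leq_card/subsetP=> _ /imsetP[c cA ->].
  move: cA; rewrite /A inE => /and3P[cS /eqP cw Xc].
  by rewrite inE erase_colorings //= XY.
rewrite /A !inE => /and3P[_ /eqP cw _] /and3P[_ /eqP c'w _] /ffunP ecc'.
apply/ffunP=> v; have [->|vw] := eqVneq v w; first by rewrite cw c'w.
by have := ecc' v; rewrite !ffunE (negbTE vw).
Qed.

Section Growth.
Variable S : {set V}.
Hypothesis SW : S \subset W.
(** The growth estimate for sets smaller than [S]; strong induction in [card_colorings_growth]
    discharges it. *)
Hypothesis IH : forall (S' : {set V}) w, #|S'| < #|S| -> S' \subset W -> w \in W ->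
  w \notin S' -> m * #|colorings S'| <= 2 * #|colorings (w |: S')|.

Lemma card_colorings_erase (S' : {set V}) w : #|S'| <= #|S| -> S' \subset W -> w \in S' ->
  m * #|colorings (S' :\ w)| <= 2 * #|colorings S'|.
Proof.
move=> S'S S'W wS'; have wW := subsetP S'W w wS'.
rewrite -{2}(setD1K wS'); apply: IH => //; last by rewrite !inE eqxx.
- by move: S'S; rewrite (cardsD1 w S') wS'.
- exact: subset_trans (subsetDl _ _) S'W.
Qed.

(** Each blocked colour costs a factor [2 * N / m]: it is used by one of at most [N] neighbours [w]
    of [u], and fixing the colour of [w] leaves at most a fraction [2 / m] of the colourings, by the
    growth estimate for [S' :\ w]. Induction on [s] multiplies these factors. *)
Lemma card_colorings_blocked (u : V) (s : seq I) (S' : {set V}) :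
  u \in U -> uniq s -> {subset s <= Q u} -> #|S'| <= #|S| -> S' \subset W ->
  m ^ size s * #|[set c : {ffun V -> option I} in colorings S' | all (mem (blocked c (Q u) u)) s]|
    <= (2 * N) ^ size s * #|colorings S'|.
Proof.
move=> uU; elim: s S' => [|i s IHs] S' /=.
  move=> _ _ _ _; rewrite !expn0 !mul1n; apply/subset_leq_card/subsetP=> c.
  by rewrite inE => /andP[].
move=> /andP[nis us] sQ S'S S'W.
have iQ : i \in Q u by apply: sQ; rewrite mem_head.
have sQ' : {subset s <= Q u} by move=> j js; apply: sQ; rewrite inE js orbT.
set Nb := [set w in W | E i u w && (i \in P w)].
pose F w := [set c : {ffun V -> option I} in colorings S' | (c w == Some i) && all (mem (blocked c (Q u) u)) s].
have le1 : #|[set c : {ffun V -> option I} in colorings S' |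
     (i \in blocked c (Q u) u) && all (mem (blocked c (Q u) u)) s]| <= \sum_(w in Nb) #|F w|.
  apply: card_le_sum_cover => c; rewrite inE => /and3P[cS' /blockedP[_ [w Ew cw]] cs].
  have wS' : w \in S'.
    apply: contraT => wS'; case/coloringsP: cS' => _ /(_ w wS').
    by rewrite cw.
  exists w; last by rewrite inE cS' cs cw eqxx.
  rewrite inE (subsetP S'W) //= Ew /=.
  by case/coloringsP: cS' => /(_ w wS')[j jP]; rewrite cw => -[->].
have le2 w : w \in Nb ->
    m ^ (size s).+1 * #|F w| <= (2 * N) ^ size s * 2 * #|colorings S'|.
  move=> wNb; have [wS'|wS'] := boolP (w \in S'); last first.
    rewrite [F w](_ : _ = set0) ?cards0 ?muln0 //; apply/setP=> c; rewrite !inE.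
    apply/negP=> /and3P[cS' /eqP cw _].
    by case/coloringsP: cS' => _ /(_ w wS'); rewrite cw.
  have sS'w : #|S' :\ w| <= #|S|.
    by apply: leq_trans S'S; apply/subset_leq_card/subsetDl.
  have := IHs (S' :\ w) us sQ' sS'w (subset_trans (subsetDl _ _) S'W).
  have := card_colorings_erase _ _ S'S S'W wS'.
  have : #|F w| <= #|[set c : {ffun V -> option I} in colorings (S' :\ w) | all (mem (blocked c (Q u) u)) s]|.
    apply: card_colorings_fix => c cw /allP cs; apply/allP=> j js.
    (* The erased vertex [w] had colour [i], which is not in [s], so the neighbour blocking [j]
       survives the erasure. *)
    have /blockedP[jQ [v Ev cv]] := cs j js.
    apply/blockedP; split=> //; exists v => //; rewrite ffunE; case: eqP => // evw.
    by move: nis; move: cv; rewrite evw cw => -[->]; rewrite js.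
  move: (#|F w|) (#|colorings (S' :\ w)|) => a b.
  set e := #|[set _ in _ | _]|; move: e => e ae bS eb.
  rewrite expnS -mulnA; apply: (@leq_trans (m * ((2 * N) ^ size s * b))).
    rewrite leq_mul2l; apply/orP; right; apply: leq_trans eb.
    by rewrite leq_mul2l ae orbT.
  by rewrite mulnCA -mulnA leq_mul2l bS orbT.
apply: leq_trans (leq_mul (leqnn _) le1) _; rewrite big_distrr /=.
apply: leq_trans (leq_sum _ le2) _; rewrite sum_nat_const expnS.
have := degUW _ _ uU iQ; rewrite -/Nb => leN.
rewrite [X in _ <= X * _](_ : _ = N * ((2 * N) ^ size s * 2)); last by lia.
by rewrite -!mulnA leq_mul2r leN orbT.
Qed.

(** Union bound over the [k]-subsets of [Q u], of which there are at most [2 ^ L]. *)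
Lemma card_colorings_full u : u \in U ->
  m ^ k * #|[set c : {ffun V -> option I} in colorings S | #|blocked c (Q u) u| == k]|
    <= 2 ^ L * (2 * N) ^ k * #|colorings S|.
Proof.
move=> uU.
set B := [set A in powerset (Q u) | #|A| == k].
pose F (A : {set I}) := [set c : {ffun V -> option I} in colorings S | all (mem (blocked c (Q u) u)) (enum A)].
have le1 : #|[set c : {ffun V -> option I} in colorings S | #|blocked c (Q u) u| == k]| <= \sum_(A in B) #|F A|.
  apply: card_le_sum_cover => c; rewrite inE => /andP[cS ck].
  exists (blocked c (Q u) u).
    rewrite !inE ck andbT; apply/subsetP=> i; by case/blockedP.
  by rewrite inE cS; apply/allP=> i; rewrite mem_enum.
have le2 A : A \in B -> m ^ k * #|F A| <= (2 * N) ^ k * #|colorings S|.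
  rewrite !inE => /andP[/subsetP AQ /eqP <-]; rewrite [#|A|]cardE.
  by apply: card_colorings_blocked; rewrite ?enum_uniq // => i; rewrite mem_enum => /AQ.
apply: leq_trans (leq_mul (leqnn _) le1) _; rewrite big_distrr /=.
apply: leq_trans (leq_sum _ le2) _; rewrite sum_nat_const -mulnA leq_mul2r; apply/orP; right.
apply: (@leq_trans (2 ^ #|Q u|)); last by rewrite leq_exp2l ?QL.
rewrite -card_powerset; apply/subset_leq_card/subsetP=> A; by rewrite inE => /andP[].
Qed.

(** A colour [i] of [P w] cannot be given to [w] only if a neighbour in [W] already has it ([clash])
    or some neighbour in [U] with [i] in its list has already lost [k] colours ([full]). Each event
    covers at most a quarter of the colourings of [S], so at least half of them extend by [i];
    summing over the [m] colours gives the claim. *)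
Lemma card_colorings_extend w : w \in W -> w \notin S ->
  m * #|colorings S| <= 2 * #|colorings (w |: S)|.
Proof.
move=> wW wS.
pose good i := [set c : {ffun V -> option I} in colorings S | assign c w i \in colorings (w |: S)].
pose clash i := [set c : {ffun V -> option I} in colorings S | [exists w' in W,
  [&& E i w w', i \in P w' & c w' == Some i]]].
pose full i := [set c : {ffun V -> option I} in colorings S |
  [exists u in U, [&& E i w u, i \in Q u & #|blocked c (Q u) u| == k]]].
have split i : i \in P w -> #|colorings S| <= #|good i| + #|clash i| + #|full i|.
  move=> iP; apply: (@leq_trans #|good i :|: clash i :|: full i|); last first.
    rewrite (leq_trans (leq_card_setU _ _).1) ?leq_add2r //.
    exact: (leq_card_setU _ _).1.
  apply/subset_leq_card/subsetP=> c cS; rewrite !in_setU.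
  have [//|nclash /=] := boolP (c \in clash i); first by rewrite orbT.
  have [//|nfull /=] := boolP (c \in full i); first by rewrite orbT.
  rewrite !orbF inE cS /=; case/coloringsP: (cS) => h1 h2 h3 h4.
  have noclash v : c v = Some i -> ~~ E i w v.
    move=> cv; apply: contra nclash => Ewv; rewrite inE cS /=.
    have vS : v \in S by apply: contraT => /h2; rewrite cv.
    apply/exists_inP; exists v; first exact: (subsetP SW).
    by rewrite Ewv cv eqxx andbT /=; have [j jP] := h1 _ vS; rewrite cv => -[->].
  apply/coloringsP; split=> [v|v|v v' j|u uU].
  - rewrite !inE ffunE; case: eqP => [-> _|_ /=]; first by exists i.
    exact: h1.
  - by rewrite !inE negb_or ffunE => /andP[/negbTE-> /h2].
  - rewrite !ffunE; case: eqP => [->|_]; case: eqP => [->|_].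
    + by rewrite Eirr.
    + by move=> [<-]; apply: noclash.
    + by move=> cv [ji]; rewrite -ji in cv *; rewrite Esym; apply: noclash.
    exact: h3.
  have sub : blocked (assign c w i) (Q u) u \subset i |: blocked c (Q u) u.
    apply/subsetP=> j /blockedP[jQ [v Ev]]; rewrite ffunE !in_setU1.
    case: eqP => [_ [->]|_ cv]; first by rewrite eqxx.
    by apply/orP; right; apply/blockedP; split=> //; exists v.
  (* If [u] has already lost [k] colours, the failure of [full] prevents [i] from becoming newly
     blocked at [u]. Otherwise there is room for one more blocked colour. *)
  have := h4 u uU; rewrite leq_eqVlt => /orP[uk|lt].
    have subc : blocked (assign c w i) (Q u) u \subset blocked c (Q u) u.
      apply/subsetP=> j jb; move: (subsetP sub j jb); rewrite in_setU1 => /orP[/eqP ji|//].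
      move: jb; rewrite ji => /blockedP[iQ [v Ev]]; rewrite ffunE; case: eqP => [evw _|_ cv].
        case/negP: nfull; rewrite inE cS; apply/exists_inP; exists u => //.
        by rewrite Esym -evw Ev iQ.
      by apply/blockedP; split=> //; exists v.
    exact: leq_trans (subset_leq_card subc) (h4 u uU).
  apply: leq_trans (subset_leq_card sub) _; rewrite cardsU1.
  by case: (_ \notin _); rewrite ?add0n ?add1n ?(ltnW lt).
have le_clash i : i \in P w -> 4 * #|clash i| <= #|colorings S|.
  move=> iP; set Nb := [set w' in W | E i w w' && (i \in P w')].
  pose F w' := [set c : {ffun V -> option I} in colorings S | (c w' == Some i) && predT c].
  have le1 : #|clash i| <= \sum_(w' in Nb) #|F w'|.
    apply: card_le_sum_cover => c; rewrite inE => /andP[cS /exists_inP[w' w'W /and3P[Ew iPw cw]]].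
    by exists w'; rewrite inE ?w'W ?Ew ?iPw ?cS ?cw.
  have le2 w' : w' \in Nb -> m * #|F w'| <= 2 * #|colorings S|.
    move=> _; have [wS'|wS'] := boolP (w' \in S); last first.
      rewrite [F w'](_ : _ = set0) ?cards0 ?muln0 //; apply/setP=> c; rewrite !inE.
      apply/negP=> /and3P[cS /eqP cw _].
      by case/coloringsP: cS => _ /(_ w' wS'); rewrite cw.
    apply: leq_trans (card_colorings_erase _ _ (leqnn _) SW wS').
    rewrite leq_mul2l; apply/orP; right.
    have /leq_trans := @card_colorings_fix S w' i predT predT (fun _ _ _ => isT); apply.
    by apply/subset_leq_card/subsetP=> c; rewrite inE => /andP[].
  have le3 : m * #|clash i| <= N * (2 * #|colorings S|).
    apply: leq_trans (leq_mul (leqnn _) le1) _; rewrite big_distrr /=.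
    apply: leq_trans (leq_sum _ le2) _; rewrite sum_nat_const leq_mul2r.
    by rewrite degW ?orbT.
  rewrite -(leq_pmul2l m_gt0) mulnCA.
  (* Here [4 * N * 2 <= m] is exactly [mN]. *)
  apply: leq_trans (leq_mul (leqnn _) le3) _; rewrite !mulnA leq_mul2r; apply/orP; right; lia.
have le_full i : i \in P w -> 4 * #|full i| <= #|colorings S|.
  move=> iP; set Nb := [set u in U | E i w u && (i \in Q u)].
  pose F u := [set c : {ffun V -> option I} in colorings S | #|blocked c (Q u) u| == k].
  have le1 : #|full i| <= \sum_(u in Nb) #|F u|.
    apply: card_le_sum_cover => c; rewrite inE => /andP[cS /exists_inP[u uU /and3P[Eu iQu ck]]].
    by exists u; rewrite inE ?uU ?Eu ?iQu ?cS ?ck.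
  have le2 u : u \in Nb -> m ^ k * #|F u| <= 2 ^ L * (2 * N) ^ k * #|colorings S|.
    by rewrite inE => /andP[uU _]; apply: card_colorings_full.
  have le3 : m ^ k * #|full i| <= d * (2 ^ L * (2 * N) ^ k * #|colorings S|).
    apply: leq_trans (leq_mul (leqnn _) le1) _; rewrite big_distrr /=.
    apply: leq_trans (leq_sum _ le2) _; rewrite sum_nat_const leq_mul2r.
    by rewrite degWU ?orbT.
  have mk0 : 0 < m ^ k by rewrite expn_gt0 m_gt0.
  rewrite -(leq_pmul2l mk0) mulnCA.
  apply: leq_trans (leq_mul (leqnn _) le3) _; rewrite !mulnA leq_mul2r; apply/orP; right.
  by move: mk; rewrite !mulnA.
(* Assigning [i] to [w] is injective on [good i], and for different [i] the images are disjoint,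
   being told apart by the value at [w]. *)
have le_good : \sum_(i in P w) #|good i| <= #|colorings (w |: S)|.
  pose G i := [set c : {ffun V -> option I} in colorings (w |: S) | c w == Some i].
  have gG i : i \in P w -> #|good i| <= #|G i|.
    move=> iP; rewrite -(@card_in_imset _ _ (fun c => assign c w i) (good i)) => [|c c'].
      apply/subset_leq_card/subsetP=> _ /imsetP[c cA ->].
      by move: cA; rewrite !inE => /andP[_ ->]; rewrite ffunE eqxx eqxx.
    rewrite !inE => /andP[/coloringsP[_ /(_ w wS) cw _ _] _].
    case/andP=> /coloringsP[_ /(_ w wS) c'w _ _] _ /ffunP ecc'.
    apply/ffunP=> v; have [->|vw] := eqVneq v w; first by rewrite cw c'w.
    by have := ecc' v; rewrite !ffunE (negbTE vw).
  apply: leq_trans (leq_sum _ gG) _.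
  rewrite -sum1_card (eq_bigr (fun i => \sum_(c in colorings (w |: S) | c w == Some i) 1)); last first.
    by move=> i _; rewrite -sum1_card; apply: eq_bigl => c; rewrite !inE.
  rewrite (exchange_big_dep (mem (colorings (w |: S)))) /=; last by move=> i c _ /andP[].
  apply: leq_sum => c cS; case e: (c w) => [j|]; last by rewrite big_pred0 // => i; rewrite !andbF.
  rewrite sum1_card -(card1 j); apply/subset_leq_card/subsetP=> i.
  by rewrite !inE => /and3P[_ _ /eqP[->]].
apply: leq_trans (leq_mul (leqnn 2) le_good).
rewrite -(Pm w wW) -sum_nat_const big_distrr /=; apply: leq_sum => i iP.
have arith (a b c e : nat) : e <= a + b + c -> 4 * b <= e -> 4 * c <= e -> e <= 2 * a by lia.
exact: arith (split _ iP) (le_clash _ iP) (le_full _ iP).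
Qed.

End Growth.

Lemma card_colorings_growth n (S : {set V}) w : #|S| < n -> S \subset W -> w \in W -> w \notin S ->
  m * #|colorings S| <= 2 * #|colorings (w |: S)|.
Proof.
elim: n S w => // n IHn S w Sn SW; apply: card_colorings_extend => // S' w' S'S.
by apply: IHn; apply: leq_trans S'S Sn.
Qed.

(** The empty colouring is admissible, and by the growth estimate with [0 < m] the count stays
    positive as vertices are added. *)
Lemma exists_coloring : exists c, partial_coloring W c.
Proof.
suff H n (S : {set V}) : #|S| = n -> S \subset W -> 0 < #|colorings S|.
  have /card_gt0P[c /coloringsP] := H _ W erefl (subxx _); by exists c.
elim: n S => [|n IHn] S.
  move/cards0_eq=> -> _; apply/card_gt0P; exists [ffun=> None]; apply/coloringsP; split.
  - by move=> w; rewrite inE.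
  - by move=> w _; rewrite ffunE.
  - by move=> w w' i; rewrite ffunE.
  move=> u uU; rewrite [blocked _ _ _](_ : _ = set0) ?cards0 //.
  by apply/setP=> i; rewrite in_set0; apply/negP=> /blockedP[_ [w]]; rewrite ffunE.
move=> Sn SW; have /card_gt0P[w wS] : 0 < #|S| by rewrite Sn.
have Sw : #|S :\ w| = n by apply: succn_inj; rewrite -Sn (cardsD1 w S) wS.
have SwW := subset_trans (subsetDl S [set w]) SW.
have := @card_colorings_growth n.+1 (S :\ w) w.
rewrite Sw setD1K // setD11 => /(_ (ltnSn n) SwW (subsetP SW w wS) isT).
have := IHn (S :\ w) Sw SwW.
case: #|colorings S| => //; rewrite muln0 leqn0 muln_eq0; lia.
Qed.

End Stage.

(** * Colouring all types in decreasing order *)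

(* [ty v] is the layer in which [v] lies in every graph of its list [La v]. *)
Lemma layered_coloring (V I : finType) (E : I -> rel V) (ty : V -> nat)
    (La : V -> {set I}) (m N d k h : nat) :
  (forall i, irreflexive (E i)) -> (forall i, symmetric (E i)) ->
  (forall v, ty v < h) ->
  (forall v, #|La v| = m + (h.-1 - ty v) * k) ->
  (forall v i, i \in La v ->
     #|[set w | [&& E i v w, i \in La w & ty v <= ty w]]| <= N) ->
  (forall v i, i \in La v ->
     #|[set w | [&& E i v w, i \in La w & ty w < ty v]]| <= d) ->
  0 < m -> 8 * N <= m ->
  4 * (d * 2 ^ (m + h * k) * (2 * N) ^ k) <= m ^ k ->
  exists c : V -> I, (forall v, c v \in La v) /\
    (forall v w i, c v = i -> c w = i -> ~~ E i v w).
Proof.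
move=> Eirr Esym tyh La_card up down m0 mN mk.
(* Invariant after [n] stages: exactly the types from [h - n] on are coloured, and every uncoloured
   vertex has lost at most [n * k] colours. *)
suff: forall n, n <= h -> exists c : {ffun V -> option I},
  [/\ forall v, h - n <= ty v -> exists2 i, i \in La v & c v = Some i,
      forall v, ty v < h - n -> c v = None,
      forall v w i, c v = Some i -> c w = Some i -> ~~ E i v w &
      forall u, ty u < h - n -> #|blocked V I E c (La u) u| <= n * k].
  case/(_ h (leqnn h))=> c; rewrite subnn => -[cLa _ cE _].
  have cLa' v := cLa v (leq0n _).
  have [g gLa gc] := fin_all_exists2 cLa'; exists g; split=> // v w i gv gw.
  by apply: cE; rewrite gc ?gv ?gw.
elim=> [_|n IHn nh].
  exists [ffun=> None]; rewrite subn0; split=> [v|v|v w i|u]; rewrite ?ffunE //.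
    by rewrite leqNgt tyh.
  move=> _; rewrite [blocked _ _ _ _ _ _](_ : _ = set0) ?cards0 //.
  by apply/setP=> i; rewrite in_set0; apply/negP=> /blockedP[_ [w]]; rewrite ffunE.
have [c [cLa cN cE cb]] := IHn (ltnW nh).
set t := h - n.+1; have tS : h - n = t.+1 by rewrite /t; lia.
rewrite tS in cLa cN cb.
pose free w := La w :\: blocked V I E c (La w) w.
(* A vertex of type [t] starts with [m + n * k] colours and has lost at most [n * k]. The remaining
   list is cut down to exactly [m] colours, as the stage requires. *)
have [P Pfree Pm] : exists2 P : V -> {set I}, forall w i, i \in P w -> i \in free w &
    forall w, w \in [set w | ty w == t] -> #|P w| = m.
  exists (fun w => [set i in take m (enum (free w))]) => [w i|w].
    by rewrite inE => /mem_take; rewrite mem_enum.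
  rewrite inE => /eqP wt; rewrite cardsE.
  rewrite (card_uniqP _) ?take_uniq ?enum_uniq // size_take_min -cardE.
  apply/minn_idPl; rewrite cardsD.
  have : #|La w :&: blocked V I E c (La w) w| <= n * k.
    apply: leq_trans (cb w _); last by rewrite wt.
    by apply/subset_leq_card/subsetIr.
  rewrite La_card wt; rewrite (_ : h.-1 - t = n); last by rewrite /t; lia.
  by move: #|_ :&: _|; lia.
have PLa w i : i \in P w -> i \in La w by move/Pfree; rewrite inE => /andP[].
have [] := @exists_coloring V I E [set w | ty w == t] [set u | ty u < t] P La m N d
  (m + h * k) k Eirr Esym Pm _ _ _ _ m0 mN mk.
- move=> u _; rewrite La_card leq_add2l leq_mul2r; apply/orP; right; lia.
- move=> w i; rewrite inE => /eqP wt iP; apply: leq_trans (up w i (PLa _ _ iP)).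
  apply/subset_leq_card/subsetP=> v; rewrite !inE => /and3P[/eqP-> -> /PLa->].
  by rewrite wt leqnn.
- move=> u i; rewrite inE => ut iLa; apply: leq_trans (up u i iLa).
  apply/subset_leq_card/subsetP=> v; rewrite !inE => /and3P[/eqP-> -> /PLa->].
  by rewrite ltnW.
- move=> w i; rewrite inE => /eqP wt iP; apply: leq_trans (down w i (PLa _ _ iP)).
  by apply/subset_leq_card/subsetP=> v; rewrite !inE wt => /and3P[-> -> ->].
move=> c1 [c1P c1N c1E c1b].
have c1t v i : c1 v = Some i -> ty v = t /\ i \in P v.
  move=> c1v; have vt : v \in [set w | ty w == t].
    by apply: contraT => /c1N; rewrite c1v.
  by split; [move: vt; rewrite inE => /eqP | have [j jP] := c1P v vt; rewrite c1v => -[->]].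
have c_t v i : c v = Some i -> t < ty v.
  by move=> cv; rewrite ltnNge; apply/negP=> vt; move: (cN v); rewrite cv ltnS vt => /(_ isT).
pose c' : {ffun V -> option I} := [ffun v => if ty v == t then c1 v else c v].
have c'E v i : c' v = Some i -> c1 v = Some i \/ c v = Some i.
  by rewrite ffunE; case: eqP; [left | right].
(* Conflicts between the new and the earlier types are excluded because [P] avoids the colours
   already blocked. *)
have mixed v w i : c1 v = Some i -> c w = Some i -> ~~ E i v w.
  move=> /c1t[vt /Pfree]; rewrite in_setD => /andP[nb iLa] cw.
  by apply: contra nb => Evw; apply/blockedP; split=> //; exists w.
exists c'; split=> [v|v vt|v w i|u ut].
- rewrite leq_eqVlt ffunE => /orP[/eqP vt|vt].
    rewrite -vt eqxx; have [|i iP c1v] := c1P v; first by rewrite inE vt.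
    by exists i => //; apply: PLa.
  by rewrite (gtn_eqF vt); apply: cLa.
- by rewrite ffunE (ltn_eqF vt); apply: cN; apply: ltnW.
- move=> /c'E[cv|cv] /c'E[cw|cw].
  + exact: c1E cv cw.
  + exact: mixed cv cw.
  + by rewrite Esym; apply: mixed cw cv.
  + exact: cE cv cw.
have sub : blocked V I E c' (La u) u \subset
    blocked V I E c1 (La u) u :|: blocked V I E c (La u) u.
  apply/subsetP=> i /blockedP[iLa [w Ew /c'E[cw|cw]]]; rewrite in_setU; apply/orP.
    by left; apply/blockedP; split=> //; exists w.
  by right; apply/blockedP; split=> //; exists w.
apply: leq_trans (subset_leq_card sub) _; rewrite mulSn.
apply: leq_trans (leq_card_setU _ _).1 _; apply: leq_add.
  by apply: c1b; rewrite inE.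
by apply: cb; apply: ltnW.
Qed.

(** * Listing the words of the tree so that parents precede children *)

(* Heads of the list are added last; each new word has its parent in the list. *)
Inductive grown (q h : nat) : seq (seq 'I_q) -> Prop :=
| grown_root : grown q h [:: [::]]
| grown_child D s a : grown q h D -> s \in D -> size s < h ->
    rcons s a \notin D -> grown q h (rcons s a :: D).

(** The pairs in [p] are pending requests for a child of a word; they are served one at a time, and
    a child already present is skipped. *)
Lemma grown_children q h D (p : seq (seq 'I_q * 'I_q)) : grown q h D ->
  (forall x, x \in p -> x.1 \in D /\ size x.1 < h) ->
  exists D', [/\ grown q h D', {subset D <= D'} &
    forall x, x \in p -> rcons x.1 x.2 \in D'].
Proof.
move=> gD; elim: p => [|[s a] p IHp] pD; first by exists D; split.
have [x xp|D' [gD' DD' pD']] := IHp.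
  by apply: pD; rewrite inE xp orbT.
have [sD sh] := pD (s, a) (mem_head _ _); rewrite /= in sD sh.
have [saD|saD] := boolP (rcons s a \in D').
  by exists D'; split=> // x; rewrite inE => /orP[/eqP->|/pD'].
exists (rcons s a :: D'); split; first by constructor=> //; apply: DD'.
  by move=> x xD; rewrite inE DD' ?orbT.
by move=> x; rewrite !inE => /orP[/eqP->|/pD' ->]; rewrite ?eqxx ?orbT.
Qed.

Lemma grown_all q h : exists2 D, grown q h D & forall s : seq 'I_q, size s <= h -> s \in D.
Proof.
suff: forall n, n <= h -> exists2 D, grown q h D &
    forall s : seq 'I_q, size s <= n -> s \in D by apply.
elim=> [_|n IHn nh].
  by exists [:: [::]]; [constructor | case].
have [D gD Dn] := IHn (ltnW nh).
pose p := [seq x <- allpairs pair D (enum 'I_q) | size x.1 < h].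
have [|D' [gD' DD' pD']] := @grown_children q h D p gD.
  move=> [s a]; rewrite mem_filter => /andP[sh /allpairsP[[s' a'] /= [sD _ [es _]]]].
  by rewrite es in sh *.
exists D' => // s; case/lastP: s => [|s a]; first by move=> _; apply/DD'/Dn.
rewrite size_rcons => sn; apply: (pD' (s, a)); rewrite mem_filter /=.
rewrite (leq_trans sn nh) /=; apply/allpairsP; exists (s, a).
by rewrite Dn // mem_enum.
Qed.

(** * Layers of a tree-free graph *)

Section Layers.
Variables (G : sgraph) (N : nat).

Fixpoint upper (j : nat) : {set vert G} :=
  if j is j'.+1 then [set x | N <= #|[set y in upper j' | adj x y]|] else setT.

Lemma upperS j x : (x \in upper j.+1) = (N <= #|[set y in upper j | adj x y]|).
Proof. by rewrite inE. Qed.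

(** Each word [s] is placed in level [h - size s], so while [size s < h] its image has at least [N]
    neighbours in the next lower level. Fewer than [N] vertices are occupied when a new word
    arrives, which leaves a free neighbour for it. *)
Lemma upper_contains_tree q h D r : grown q h D -> size D <= N -> r \in upper h ->
  exists phi : seq 'I_q -> vert G,
    [/\ {in D &, injective phi},
        forall s, s \in D -> phi s \in upper (h - size s) &
        forall s a, rcons s a \in D -> s \in D /\ adj (phi s) (phi (rcons s a))].
Proof.
move=> gD; elim: gD => {D} [_ rh|D s a gD IHD sD sh saD DN rh].
  exists (fun _ => r); split=> [s t|s|s a]; rewrite !inE.
  - by move=> /eqP-> /eqP->.
  - by move=> /eqP->; rewrite subn0.
  by rewrite -size_eq0 size_rcons.
have [phi [inj up edge]] := IHD (ltnW DN) rh.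
have [y yup yD] : exists2 y, y \in [set y in upper (h - (size s).+1) | adj (phi s) y] &
    y \notin map phi D.
  apply/exists_inP; apply: contraT; rewrite negb_exists_in => /forall_inP all_in.
  have := up s sD; rewrite [h - size s](_ : _ = (h - (size s).+1).+1); last by lia.
  rewrite upperS leqNgt => /negP[].
  apply: leq_trans DN; rewrite /= ltnS -(size_map phi).
  apply: leq_trans (card_size _).
  by apply/subset_leq_card/subsetP=> y /all_in; rewrite negbK.
move: yup; rewrite inE => /andP[yup adj_y].
have neq t : t \in D -> (t == rcons s a) = false.
  by move=> tD; apply: contraNF saD => /eqP <-.
exists (fun t => if t == rcons s a then y else phi t); split=> [t t'|t|t b].
- rewrite !inE; case: eqP => [->|_] /= tD; case: eqP => [->|_] //= t'D.
  + by move=> yt; case/negP: yD; rewrite yt map_f.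
  + by move=> ty; case/negP: yD; rewrite -ty map_f.
  exact: inj.
- by rewrite inE; case: eqP => [-> _|_ /= /up //]; rewrite size_rcons.
rewrite inE => /orP[/eqP e|tbD].
  rewrite e eqxx; have [-> _] := rcons_inj e.
  by rewrite neq // inE sD orbT.
have [tD adj_t] := edge t b tbD.
by rewrite !neq // inE tD orbT.
Qed.

Variables (q h : nat) (D : seq (seq 'I_q)).
Hypothesis gD : grown q h D.
Hypothesis Dall : forall s : seq 'I_q, size s <= h -> s \in D.
Hypothesis DN : size D <= N.
Hypothesis noT : ~ contains_qary_tree q h G.

Lemma upper_eq0 x : x \notin upper h.
Proof.
apply/negP=> xh; apply: noT.
have [phi [inj _ edge]] := upper_contains_tree q h D x gD DN xh.
exists phi; split=> [s t sh th|s a sh]; first by apply: inj; apply: Dall.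
by have [|//] := edge s a; apply: Dall; rewrite size_rcons.
Qed.

(** The search stops at the first failure, so [x] lies in every level up to [layer x]. For [0 < h] a
    failure occurs at [h.-1] at the latest, by [upper_eq0]. *)
Definition layer x := find (fun j => x \notin upper j.+1) (seq.iota 0 h).

Lemma layer_has x : 0 < h -> has (fun j => x \notin upper j.+1) (seq.iota 0 h).
Proof.
move=> h0; apply/hasP; exists h.-1; first by rewrite mem_iota /=; lia.
by rewrite prednK //; apply: upper_eq0.
Qed.

Lemma layer_lt x : 0 < h -> layer x < h.
Proof. by move/(layer_has x); rewrite has_find size_iota. Qed.

Lemma mem_upper_layer x j : 0 < h -> j <= layer x -> x \in upper j.
Proof.
move=> h0; case: j => [|j] jx; first by rewrite inE.
have := @before_find _ 0 (fun j => x \notin upper j.+1) (seq.iota 0 h) j jx.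
by move=> /negbFE; rewrite nth_iota // (leq_trans jx) // ltnW ?layer_lt.
Qed.

(** Neighbours of at least the same layer all lie in [upper (layer x)], and [x] misses the next
    level, so it has fewer than [N] of them. *)
Lemma card_layer_up x : 0 < h -> #|[set y | adj x y && (layer x <= layer y)]| <= N.
Proof.
move=> h0; have := nth_find 0 (layer_has x h0); rewrite nth_iota ?layer_lt // add0n.
rewrite upperS -ltnNge => /ltnW; apply: leq_trans.
apply/subset_leq_card/subsetP=> y; rewrite !inE => /andP[-> xy].
by rewrite andbT; apply: mem_upper_layer.
Qed.

End Layers.

(** * From layers to cooperative colourings *)

Lemma exists_subset_card (T : finType) (A : {set T}) n : n <= #|A| ->
  exists2 B : {set T}, B \subset A & #|B| = n.
Proof.
move=> nA; exists [set i in take n (enum A)].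
  by apply/subsetP=> i; rewrite inE => /mem_take; rewrite mem_enum.
rewrite cardsE (card_uniqP _) ?take_uniq ?enum_uniq // size_take_min -cardE.
exact/minn_idPl.
Qed.

Lemma pigeonhole_classes (T : finType) (A : {set T}) (h : nat) (c : T -> nat) (l : nat -> nat) :
  0 < h -> (forall x, x \in A -> c x < h) -> \sum_(s < h) l s <= #|A| ->
  exists s : 'I_h, l s <= #|[set x in A | c x == s]|.
Proof.
move=> h0 ch lA; apply/existsP; apply: contraT => /existsPn small.
suff: #|A| < \sum_(s < h) l s by rewrite ltnNge lA.
apply: (@leq_ltn_trans (\sum_(s < h) #|[set x in A | c x == s]|)).
  rewrite -[in leqLHS]sum1_card (eq_bigr (fun s : 'I_h => \sum_(x in A | c x == s) 1)); last first.
    by move=> s _; rewrite -sum1_card; apply: eq_bigl => x; rewrite !inE.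
  rewrite (exchange_big_dep (mem A)) /=; last by move=> s x _ /andP[].
  apply: leq_sum => x xA; rewrite (big_pred1 (Ordinal (ch x xA))) // => s.
  by rewrite xA /= eq_sym.
have lt (s : 'I_h) : #|[set x in A | c x == s]| < l s by rewrite ltnNge small.
(* One strict term suffices for a strict sum; class [0] exists because [0 < h]. *)
rewrite (bigD1 (Ordinal h0)) //= [ltnRHS](bigD1 (Ordinal h0)) //= -addSn.
apply: leq_add; first exact: (lt (Ordinal h0)).
by apply: leq_sum => s _; apply/ltnW/lt.
Qed.

(** [N] is the length of a list containing all words of length at most [h], hence depends on [q] and
    [h] only. *)
Lemma tree_free_coop_prop q h : 0 < h -> exists2 N, 0 < N & forall (H : sgraph -> Prop) d m k,
  (forall G, H G -> ~ contains_qary_tree q h G) ->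
  0 < m -> 8 * N <= m ->
  h = 1 \/ 4 * (d * 2 ^ (m + h * k) * (2 * N) ^ k) <= m ^ k ->
  coop_prop H d (\sum_(s < h) (m + (h.-1 - s) * k)).
Proof.
move=> h0; have [D gD Dall] := grown_all q h.
exists (size D) => [|H d m k noT m0 mN mk V n G f HG finj Gd Vl].
  by rewrite lt0n size_eq0; apply: contraTneq (Dall [::] isT) => ->.
set N := size D in mN mk.
have noT' i : ~ contains_qary_tree q h (G i) by apply: noT.
pose lay i (x : vert (G i)) := layer (G i) N h x.
have layh i x : lay i x < h by apply: (layer_lt (G i) N q h D gD Dall).
have layup i x : #|[set y | adj x y && (lay i x <= lay i y)]| <= N.
  exact: (card_layer_up (G i) N q h D gD Dall).
(* The default [h] is not a valid type; it occurs only for graphs that miss [v], and the pigeonhole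
   ranges over graphs containing [v]. *)
pose layV (v : V) i := if [pick x | f i x == v] is Some x then lay i x else h.
have layVE i x : layV (f i x) i = lay i x.
  rewrite /layV; case: pickP => [y /eqP/finj-> //|/(_ x)]; by rewrite eqxx.
pose E i (v w : V) := [exists x, exists y, [&& f i x == v, f i y == w & adj x y]].
have EP i v w : reflect (exists x y, [/\ f i x = v, f i y = w & adj x y]) (E i v w).
  apply: (iffP existsP) => -[x].
    by case/existsP=> y /and3P[/eqP ? /eqP ? ?]; exists x, y.
  by case=> y [<- <- xy]; exists x; apply/existsP; exists y; rewrite !eqxx.
have Eirr i : irreflexive (E i).
  move=> v; apply/EP=> -[x [y [<- /finj -> ]]].
  by rewrite adj_irr.
have Esym i : symmetric (E i).
  by move=> v w; apply/EP/EP=> -[x [y [<- <- xy]]]; exists y, x; rewrite adj_sym.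
have [ty_La ty_LaP] : exists t : V -> 'I_h * {set 'I_n}, forall v,
    #|(t v).2| = m + (h.-1 - (t v).1) * k /\
    forall i, i \in (t v).2 -> exists2 x, f i x = v & lay i x = (t v).1.
  apply: (fin_all_exists (P := fun v (t : 'I_h * {set 'I_n}) => #|t.2| = m + (h.-1 - t.1) * k /\
    forall i, i \in t.2 -> exists2 x, f i x = v & lay i x = t.1)) => v.
  have [|s] := @pigeonhole_classes _ _ h (layV v) (fun s => m + (h.-1 - s) * k) h0 _ (Vl v).
    by move=> i; rewrite inE => /codomP[x ->]; rewrite layVE.
  case/exists_subset_card=> B /subsetP BA Bcard; exists (s, B); split=> // i /BA.
  by rewrite !inE => /andP[/codomP[x ->]]; rewrite layVE => /eqP ?; exists x.
pose ty v : nat := (ty_La v).1; pose La v := (ty_La v).2.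
have tyP v i : i \in La v -> exists2 x, f i x = v & lay i x = ty v.
  by move=> iv; have [_] := ty_LaP v; apply.
have cardE i v (X : pred V) (Y : pred (vert (G i))) x : f i x = v ->
    (forall y, X (f i y) -> Y y) ->
    #|[set w | E i v w && X w]| <= #|[set y | adj x y && Y y]|.
  move=> fx XY; apply: leq_trans (leq_imset_card (f i) _).
  apply/subset_leq_card/subsetP=> w; rewrite inE => /andP[/EP[x' [y [fx' <- xy]]] Xy].
  apply: imset_f; rewrite inE XY // andbT.
  by move: fx'; rewrite -fx => /finj <-.
(* For [h = 1] no vertex has a neighbour of smaller type, so the degree bound [0] is valid and makes
   the growth condition trivial. *)
pose d' := if h == 1 then 0 else d.
have [||v i iv|v i iv||c [cLa cE]] := @layered_coloring V 'I_n E ty La m N d' k h Eirr Esym _ _ _ _ m0 mN.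
- by move=> v; rewrite /ty.
- by move=> v; case: (ty_LaP v).
- have [x fx xt] := tyP v i iv; apply: leq_trans (layup i x).
  apply: cardE => // y /andP[/tyP[y' /finj -> ->]]; by rewrite xt.
- rewrite /d'; case: eqP => [h1|_].
    rewrite leqn0 cards_eq0; apply/eqP/setP=> w; rewrite !inE.
    have -> : ty v = 0 by have := ltn_ord (ty_La v).1; rewrite -/(ty v); lia.
    by rewrite ltn0 !andbF.
  have [x fx xt] := tyP v i iv; apply: leq_trans (Gd i x).
  apply: leq_trans (cardE i v _ predT x fx (fun _ _ => isT)) _.
  by apply/subset_leq_card/subsetP=> y; rewrite !inE andbT.
- by rewrite /d'; case: eqP mk => // h1 [].
exists (fun i => [set x | c (f i x) == i]); split=> [i x y|v].
  rewrite !inE => /eqP cx /eqP cy; apply/negP=> xy.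
  by case/negP: (cE _ _ _ cx cy); apply/EP; exists x, y.
have [x fx _] := tyP v (c v) (cLa v); exists (c v); exists x => //.
by rewrite inE fx.
Qed.

(** * Choice of parameters and asymptotics *)

Section Numerics.
Local Open Scope R_scope.

Lemma INR_expn (a b : nat) : INR (expn a b) = INR a ^ b.
Proof. by elim: b => //= b IHb; rewrite expnS mult_INR IHb. Qed.

Lemma ln_two_le1 : ln 2 <= 1.
Proof.
rewrite -[X in _ <= X]ln_exp; apply: ln_le; first lra.
by have := exp_ineq1_le 1; lra.
Qed.

Lemma Rle_ln_inv a b : 0 < a -> 0 < b -> ln a <= ln b -> a <= b.
Proof.
by move=> a0 b0 ab; apply: Rnot_lt_le => ba; have := ln_increasing b a b0 ba; lra.
Qed.

(** Take logarithms and use [ln 2 <= 1]: the factor [4] contributes at most [2], the power of two at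
    most [m + h * k], and [(2 * N) ^ k] at most [k * (1 + ln N)]. *)
Lemma growth_condition (d m k N h : nat) : (0 < d)%N -> (0 < m)%N -> (0 < N)%N ->
  ln (INR d) + INR m + 2 <= INR k * (ln (INR m) - (INR h + 1 + ln (INR N))) ->
  (4 * (d * 2 ^ (m + h * k) * (2 * N) ^ k) <= m ^ k)%N.
Proof.
move=> d0 m0 N0 le.
have pos a : (0 < a)%N -> 0 < INR a by move=> a0; apply/lt_0_INR/ltP.
have d0' := pos d d0; have m0' := pos m m0; have N0' := pos N N0.
apply/leP/INR_le; rewrite !mult_INR !INR_expn !mult_INR.
rewrite [INR 4](_ : _ = 2 ^ 2); last by simpl; lra.
rewrite [INR 2](_ : _ = 2); last by simpl; lra.
have p2 n : 0 < 2 ^ n by apply: pow_lt; lra.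
have p3 : 0 < (2 * INR N) ^ k by apply: pow_lt; lra.
have p4 : 0 < INR d * 2 ^ (m + h * k) by apply: Rmult_lt_0_compat.
apply: Rle_ln_inv; first by do 2 apply: Rmult_lt_0_compat => //.
  exact: pow_lt.
rewrite !ln_mult ?ln_pow //; try lra; try by apply: Rmult_lt_0_compat.
rewrite ln_mult // ?plus_INR ?mult_INR; try lra.
have := ln_two_le1; have := ln_lt_2; have := pos_INR m; have := pos_INR h; have := pos_INR k.
move=> k0 h0 m0'' _ l2.
have hk := Rmult_le_pos _ _ h0 k0.
have S1 : (INR m + INR h * INR k) * ln 2 <= (INR m + INR h * INR k) * 1.
  by apply: Rmult_le_compat_l l2; lra.
have S2 := Rmult_le_compat_l _ _ _ k0 l2.
by rewrite ln_1; lra.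
Qed.

Lemma exists_INR_ceil r : 0 <= r -> exists n : nat, r <= INR n <= r + 1.
Proof.
move=> r0; have [a b] := archimed r.
have z0 : (0 <= up r)%Z by apply: le_IZR; simpl; lra.
by exists (Z.to_nat (up r)); rewrite INR_IZR_INZ Z2Nat.id //; lra.
Qed.

(** With [x = exp y] and [D = y - 2 * ln y - c], this is the relative excess over [x / y] of [2 * (x
    / y ^ 2) + 3 + (x + x / y ^ 2 + 3) / D], the bound on [2 * m + k] after rounding up. *)
Definition overhead (c y : R) : R :=
  2 / y + 3 * (y / exp y) +
  (1 + / y * / y + 3 * / exp y) / (1 - 2 * (ln y / y) - c * / y) - 1.

Lemma is_lim_seq_comp_p (f : R -> R) (u : nat -> R) (l : Rbar) :
  is_lim f p_infty l -> is_lim_seq u p_infty -> is_lim_seq (fun n => f (u n)) l.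
Proof. by move=> fl up; apply: is_lim_comp_seq fl _ up; exists 0%N. Qed.

Lemma is_lim_seq_iter_log h : is_lim_seq (fun d => iter_log h (INR d)) p_infty.
Proof.
elim: h => [|h IHh]; first exact: is_lim_seq_INR.
exact: is_lim_seq_comp_p is_lim_ln_p IHh.
Qed.

Section Overhead.
Variables (c : R) (u : nat -> R).
Hypothesis up : is_lim_seq u p_infty.

Let inv : is_lim_seq (fun n => / u n) 0.
Proof. exact: (is_lim_seq_inv _ _ up). Qed.

Lemma is_lim_seq_overhead_denominator :
  is_lim_seq (fun n => 1 - 2 * (ln (u n) / u n) - c * / u n) 1.
Proof.
have lny : is_lim_seq (fun n => ln (u n) / u n) 0.
  exact: is_lim_seq_comp_p is_lim_div_ln_p up.
rewrite [X in Rbar.Finite X](_ : _ = 1 - 2 * 0 - c * 0); last by ring.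
apply: is_lim_seq_minus'; last exact: (is_lim_seq_scal_l _ c 0 inv).
apply: is_lim_seq_minus'; first exact: is_lim_seq_const.
exact: (is_lim_seq_scal_l _ 2 0 lny).
Qed.

Lemma is_lim_seq_overhead : is_lim_seq (fun n => overhead c (u n)) 0.
Proof.
have inve : is_lim_seq (fun n => / exp (u n)) 0.
  exact: (is_lim_seq_inv _ _ (is_lim_seq_comp_p _ _ _ is_lim_exp_p up)).
have ye : is_lim_seq (fun n => u n / exp (u n)) 0.
  apply: (is_lim_seq_ext (fun n => / (exp (u n) / u n))) => [n|].
    by rewrite Rinv_div.
  exact: (is_lim_seq_inv _ _ (is_lim_seq_comp_p _ _ _ is_lim_div_exp_p up)).
rewrite [X in Rbar.Finite X](_ : _ = 2 * 0 + 3 * 0 + (1 + 0 * 0 + 3 * 0) / 1 - 1); last by field.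
apply: is_lim_seq_minus'; last exact: is_lim_seq_const.
apply: is_lim_seq_plus'.
  apply: is_lim_seq_plus'; last exact: (is_lim_seq_scal_l _ 3 0 ye).
  exact: (is_lim_seq_scal_l _ 2 0 inv).
apply: is_lim_seq_div'; [|exact: is_lim_seq_overhead_denominator|lra].
apply: is_lim_seq_plus'; last exact: (is_lim_seq_scal_l _ 3 0 inve).
by apply: is_lim_seq_plus'; [exact: is_lim_seq_const | exact: is_lim_seq_mult'].
Qed.

End Overhead.

Lemma eventually_gt (u : nat -> R) M : is_lim_seq u p_infty -> eventually (fun n => M < u n).
Proof. by move/is_lim_seq_spec; apply. Qed.

Lemma eventually_gt_finite (u : nat -> R) (l M : R) : is_lim_seq u l -> M < l ->
  eventually (fun n => M < u n).
Proof.
move=> /is_lim_seq_spec ul Ml; have e0 : 0 < l - M by lra.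
have [n un] := ul (mkposreal _ e0); exists n => k nk.
by have := un k nk; move/Rabs_def2 => /=; lra.
Qed.

(** Here [m] is about [x / y ^ 2], negligible against [x / y], while [ln m] is still at least
    [y - 2 * ln y]. *)
Lemma exists_parameters (N h : nat) : (0 < N)%N ->
  eventually (fun d => exists m k : nat,
    [/\ (0 < m)%N, (8 * N <= m)%N,
        (4 * (d * 2 ^ (m + h * k) * (2 * N) ^ k) <= m ^ k)%N &
        INR (2 * m + k) <= (1 + overhead (INR h + 1 + ln (INR N)) (ln (ln (INR d)))) *
          (ln (INR d) / ln (ln (INR d)))]).
Proof.
move=> N0; set c := INR h + 1 + ln (INR N).
have yp : is_lim_seq (fun d => ln (ln (INR d))) p_infty := is_lim_seq_iter_log 2.
have xp : is_lim_seq (fun d => ln (INR d)) p_infty := is_lim_seq_iter_log 1.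
have D1 := is_lim_seq_overhead_denominator c _ yp.
have e0 : 0 < 1 by lra.
have := eventually_gt _ 0 yp; have := eventually_gt _ 0 xp; have := eventually_gt _ 0 is_lim_seq_INR.
have := eventually_gt _ (27 * INR (8 * N)) yp; have := eventually_gt_finite _ _ 0 D1 e0.
move=> H1 H2 H3 H4 H5.
have [n H] := filter_and _ _ H1 (filter_and _ _ H2 (filter_and _ _ H3 (filter_and _ _ H4 H5))).
exists n => d /H{H H1 H2 H3 H4 H5 D1 xp yp} [D0 [sq [d0 [x0 y0]]]].
set x := ln (INR d) in sq x0 y0 D0 *; set y := ln x in sq y0 D0 *.
have ey : exp y = x by rewrite exp_ln.
have N0' : 0 < INR N by apply/lt_0_INR/ltP.
have xyy : 0 < x / y / y by do 2 apply: Rdiv_lt_0_compat => //.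
(* Cubing [y / 3 <= exp (y / 3)] gives the constant 27; consequently [x / y ^ 2 >= y / 27], which
   exceeds [8 * N] eventually. *)
have cube : y * y * y <= 27 * x.
  have /Rlt_le y3 : y / 3 < exp (y / 3) by have := exp_ineq1_le (y / 3); lra.
  have -> : x = exp (y / 3) ^ 3.
    by rewrite -ey /= Rmult_1_r -!exp_plus; congr exp; field.
  have -> : y * y * y = 27 * (y / 3) ^ 3 by field.
  by apply: Rmult_le_compat_l; [lra | apply: pow_incr; lra].
have {}sq : INR (8 * N) < x / y / y.
  apply: (Rlt_le_trans _ (y / 27)); first lra.
  have -> : y / 27 = y * y * y / 27 * (/ y * / y) by field; lra.
  have -> : x / y / y = x * (/ y * / y) by field; lra.
  apply: Rmult_le_compat_r; last lra.
  by apply/Rlt_le/Rmult_lt_0_compat; apply: Rinv_0_lt_compat.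
have [m [m1 m2]] := exists_INR_ceil _ (Rlt_le _ _ xyy).
have [m0 mN] : (0 < m)%N /\ (8 * N <= m)%N.
  have /INR_lt : INR (8 * N) < INR m by lra.
  by move/ltP => lt; split; [apply: leq_ltn_trans lt | apply: ltnW].
(* [D] is a lower bound for the factor of [k] in [growth_condition], so [k] is obtained by rounding
   up [(x + m + 2) / D]. *)
pose D := y - 2 * ln y - c.
have Dy : D = y * (1 - 2 * (ln y / y) - c * / y) by rewrite /D; field; lra.
have Dpos : 0 < D by rewrite Dy; apply: Rmult_lt_0_compat.
have r0 : 0 <= (x + INR m + 2) / D.
  by apply/Rlt_le/Rdiv_lt_0_compat => //; lra.
have [k [k1 k2]] := exists_INR_ceil _ r0.
have lnm : y - 2 * ln y <= ln (INR m).
  apply: Rle_trans (ln_le _ _ xyy m1); rewrite /Rdiv !ln_mult ?ln_Rinv //; try exact: Rinv_0_lt_compat.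
    by rewrite -/y; lra.
  by apply: Rmult_lt_0_compat => //; apply: Rinv_0_lt_compat.
exists m, k; split=> //.
  apply: growth_condition => //; first by apply/ltP/INR_lt.
  rewrite -/x -/c; apply: (Rle_trans _ (INR k * D)); last first.
    by apply: Rmult_le_compat_l; [exact: pos_INR | rewrite /D; lra].
  have := Rmult_le_compat_r D _ _ (Rlt_le _ _ Dpos) k1.
  by rewrite /Rdiv Rmult_assoc Rinv_l; lra.
rewrite -/x -/y.
have -> : (1 + overhead c y) * (x / y) = 2 * (x / y / y) + 3 + (x + x / y / y + 3) / D.
  have Dn0 : y - 2 * ln y - c <> 0 by move: Dpos; rewrite /D; lra.
  by rewrite /overhead ey Dy; field; repeat split; lra.
rewrite plus_INR mult_INR; simpl (INR 2).
suff : (x + INR m + 2) / D <= (x + x / y / y + 3) / D by lra.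
by apply: Rmult_le_compat_r; [apply/Rlt_le/Rinv_0_lt_compat | lra].
Qed.
Lemma eventually_lt_finite (u : nat -> R) (l M : R) : is_lim_seq u l -> l < M ->
  eventually (fun n => u n < M).
Proof.
move=> /is_lim_seq_opp ul lM.
have [|n un] := eventually_gt_finite _ (- l) (- M) ul; first lra.
by exists n => k /un; lra.
Qed.

(** Since [ln z <= z - 1] for positive [z], a further logarithm only decreases the value once the
    inner iterate is positive. *)
Lemma eventually_iter_log_le h : (3 <= h)%N ->
  eventually (fun d => iter_log h (INR d) <= ln (ln (ln (INR d)))).
Proof.
elim: h => // h IHh; rewrite leq_eqVlt => /orP[/eqP <-|h3].
  by exists 0%N => d _; exact: Rle_refl.
have [n Hn] := filter_and _ _ (IHh h3) (eventually_gt _ 0 (is_lim_seq_iter_log h)).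
exists n => d /Hn [le pos]; apply: Rle_trans le.
have := exp_ineq1_le (iter_log h.+1 (INR d)).
by rewrite [X in exp X]/(iter_log h.+1 _) /= -/(iter_log h (INR d)) exp_ln //; lra.
Qed.

(** For [h >= 3] the denominator is at most [ln y], which is [o(y)]. Thus [x / iter_log h d]
    eventually exceeds any constant multiple of [x / y], and the crude factor [h * h] is
    absorbed. *)
Lemma exists_parameters_high (N h : nat) : (0 < N)%N -> (3 <= h)%N ->
  eventually (fun d => exists m k : nat,
    [/\ (0 < m)%N, (8 * N <= m)%N,
        (4 * (d * 2 ^ (m + h * k) * (2 * N) ^ k) <= m ^ k)%N &
        INR (h * h * (2 * m + k)) <= ln (INR d) / iter_log h (INR d)]).
Proof.
move=> N0 h3.
have yp : is_lim_seq (fun d => ln (ln (INR d))) p_infty := is_lim_seq_iter_log 2.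
have xp : is_lim_seq (fun d => ln (INR d)) p_infty := is_lim_seq_iter_log 1.
have lny : is_lim_seq (fun d => ln (ln (ln (INR d))) / ln (ln (INR d))) 0.
  exact: is_lim_seq_comp_p is_lim_div_ln_p yp.
have h0 : 0 < 2 * INR (h * h).
  apply: Rmult_lt_0_compat; first lra.
  by apply/lt_0_INR/ltP; rewrite muln_gt0 (leq_trans _ h3).
have [n Hn] := filter_and _ _ (exists_parameters N h N0)
  (filter_and _ _ (eventually_lt_finite _ _ 1 (is_lim_seq_overhead (INR h + 1 + ln (INR N)) _ yp) Rlt_0_1)
  (filter_and _ _ (eventually_lt_finite _ _ _ lny (Rinv_0_lt_compat _ h0))
  (filter_and _ _ (eventually_gt _ 0 yp) (filter_and _ _ (eventually_gt _ 0 xp)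
  (filter_and _ _ (eventually_iter_log_le _ h3) (eventually_gt _ 0 (is_lim_seq_iter_log h))))))).
exists n => d /Hn {Hn yp xp lny} [[m [k [m0 mN cond le]]] [e1 [lny [y0 [x0 [zle z0]]]]]].
exists m, k; split=> //; rewrite mult_INR.
move: (overhead _ _) le e1 => e le e1.
move: (ln (INR d)) (ln (ln (INR d))) (iter_log _ _) x0 y0 z0 zle lny le => x y z x0 y0 z0 zle lny le.
have xy0 : 0 < x / y by apply: Rdiv_lt_0_compat.
have le2 : INR (2 * m + k) <= 2 * (x / y).
  by apply: Rle_trans le _; apply: Rmult_le_compat_r; lra.
(* Combines [z <= ln y] with [ln y / y] being below [/ (2 * INR (h * h))]. *)
have hz : 2 * INR (h * h) * z <= y.
  have : ln y < / (2 * INR (h * h)) * y by apply/Rlt_div_l.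
  move=> lt; have := Rmult_le_compat_l _ _ _ (Rlt_le _ _ h0) (Rlt_le _ _ (Rle_lt_trans _ _ _ zle lt)).
  by rewrite -Rmult_assoc Rinv_r; lra.
apply: (Rle_trans _ (2 * INR (h * h) * (x / y))).
  by have := Rmult_le_compat_l _ _ _ (pos_INR (h * h)) le2; lra.
apply: (proj1 (Rle_div_r _ _ _ z0)).
have -> : 2 * INR (h * h) * (x / y) * z = 2 * INR (h * h) * z * (x / y) by ring.
have := Rmult_le_compat_r _ _ _ (Rlt_le _ _ xy0) hz.
by have -> : y * (x / y) = x by field; lra.
Qed.

End Numerics.

(** * Assembling the cases [h = 1], [h = 2] and [h >= 3] *)

Theorem theorem2 :
  forall q : nat, 2 <= q ->
  exists C : R,
  forall h : nat, 1 <= h ->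
  exists eps : nat -> R, Un_cv eps 0%R /\
  exists d0 : nat,
  forall H : sgraph -> Prop,
    (forall G, H G -> ~ contains_qary_tree q h G) ->
    forall d : nat, d0 <= d ->
      ell_le H d ((1 + eps d) * (ln (INR d) / iter_log h (INR d)) + C)%R.
Proof.
move=> q _; have [N1 N1_gt0 coop1] := tree_free_coop_prop q 1 isT.
(* The constant must precede [h]; it is dictated by the case [h = 1] and so depends on [q] only. *)
exists (INR (8 * N1)) => -[//|[|[|h]]] _.
- exists (fun _ => 0%R); split; first exact/is_lim_seq_Reals/is_lim_seq_const.
  (* For [d >= 3] the logarithm is positive, so the quotient [ln d / ln d] is [1]. *)
  exists 3 => H noT d d3; exists (8 * N1); split.
    have d1 : (1 < INR d)%R by apply: (lt_INR 1); apply/ltP/(leq_trans _ d3).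
    have := ln_increasing 1 (INR d); rewrite ln_1 /iter_log /= => lnd.
    by rewrite /Rdiv Rinv_r; lra.
  have := coop1 H d (8 * N1) 0 noT; rewrite big_ord1 muln0 addn0; apply=> //.
  - by rewrite muln_gt0.
  - by left.
- have [N N_gt0 coop] := tree_free_coop_prop q 2 isT.
  exists (fun d => overhead (INR 2 + 1 + ln (INR N)) (ln (ln (INR d)))); split.
    apply/is_lim_seq_Reals; apply: is_lim_seq_overhead; exact: (is_lim_seq_iter_log 2).
  have [d0 param] := exists_parameters N 2 N_gt0; exists d0 => H noT d /leP/param.
  case=> m [k [m0 mN cond le]]; exists (2 * m + k); split.
    by have := pos_INR (8 * N1); rewrite [iter_log 2 _]/=; lra.
  have -> : 2 * m + k = \sum_(s < 2) (m + (2.-1 - s) * k).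
    by rewrite !big_ord_recl big_ord0 /=; rewrite /bump /= ?subnn ?subn0 ?mul1n ?mul0n; lia.
  exact: coop H d m k noT m0 mN (or_intror cond).
have [N N_gt0 coop] := tree_free_coop_prop q h.+3 isT.
exists (fun _ => 0%R); split; first exact/is_lim_seq_Reals/is_lim_seq_const.
have [d0 param] := exists_parameters_high N h.+3 N_gt0 isT.
exists d0 => H noT d /leP/param[m [k [m0 mN cond le]]].
exists (\sum_(s < h.+3) (m + (h.+3.-1 - s) * k)); split; last first.
  exact: coop H d m k noT m0 mN (or_intror cond).
(* Crude bound: each of the [h.+3] summands is at most [h.+3 * (2 * m + k)]. *)
have : (INR (\sum_(s < h.+3) (m + (h.+3.-1 - s) * k)) <= INR (h.+3 * h.+3 * (2 * m + k)))%R.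
  apply/le_INR/leP; rewrite -mulnA -[X in _ <= X * _](card_ord h.+3) -sum_nat_const.
  by apply: leq_sum => s _; nia.
by have := pos_INR (8 * N1); lra.
Qed.
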